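(* Let $X_1,\dots,X_n$ be independent unbiased estimators of an unknown parameter $\theta$ with finite (positive) variances $\sigma_1^2,\dots,\sigma_n^2$, respectively. Then $\Theta=\operatorname{mean}(\&(N_1,\dots,N_n))$ is the best linear unbiased estimator for $\theta$ (based on $X_1,\dots,X_n$), where $N_1,\dots,N_n$ are the random normal distributions $N_i=N(X_i,\sigma_i^2)$, $i=1,\dots,n$.
   Context: A random variable $X$ is an unbiased estimator of $\theta$ if $E X=\theta$. If $X$ is a random variable, the random normal distribution $N(X,\sigma^2)$ is the normal distribution with variable (random) mean $X$ and fixed variance $\sigma^2$; for each realization of $X_1,\dots,X_n$ the conflation $\&(N_1,\dots,N_n)$ is formed, so it is a random probability distribution, and $\operatorname{mean}(\&(N_1,\dots,N_n))$, its mean, is a random variable. Conflation: $\delta_x$ is the Dirac measure at $x$, and $\|\mu\|$ is the total mass of a Borel sub-probability measure $\mu$. For Borel probability measures $P_1,\dots,P_n$ on $\mathbb{R}$ and $j\in\mathbb{N}$, define the sub-probability measure $$\mu_j(P_1,\dots,P_n)=\sum_{k\in\mathbb{Z}}\ \prod_{i=1}^n P_i\big(((k-1)2^{-j},k2^{-j}]\big)\,\delta_{k2^{-j}}.$$ If $\mu_j(P_1,\dots,P_n)/\|\mu_j(P_1,\dots,P_n)\|$ converges vaguely, as $j\to\infty$, to a Borel probability measure $Q$, then $Q$ is called the conflation of $P_1,\dots,P_n$ and is written $\&(P_1,\dots,P_n)$. Vague convergence $\nu_j\to\nu$ of sub-probability measures means $\int f\,d\nu_j\to\int f\,d\nu$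 for all continuous $f$ vanishing at infinity. *)

(* Defs.v *)
From HB Require Import structures.
From mathcomp Require Import all_boot all_order all_algebra.
From mathcomp Require Import all_classical all_reals all_analysis.

Set Implicit Arguments.
Unset Strict Implicit.
Unset Printing Implicit Defensive.

Import Order.TTheory GRing.Theory Num.Theory.
Import numFieldNormedType.Exports.

Local Open Scope classical_set_scope.
Local Open Scope ring_scope.

(** * Conflation of Borel probability measures on the real line *)

Section conflation.
Context {R : realType} {n : nat}.
Local Notation prob := (probability (measurableTypeR R) R).
Implicit Types (P : 'I_n -> prob) (Q : prob) (j : nat) (k : int).

Definition dyadic j k : R := k%:~R / 2 ^+ j.

Definition dyadic_cell j k : set R := `]dyadic j (k - 1), dyadic j k]%classic.

Definition dyadic_conflation P j (A : set (measurableTypeR R)) : \bar R :=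
  (\esum_(k in [set: int])
    ((\prod_(i < n) P i (dyadic_cell j k)) * \d_(dyadic j k) A))%E.

Section dyadic_conflation_measure.
Local Open Scope ereal_scope.
Variables (P : 'I_n -> prob) (j : nat).

Let weight_ge0 k : 0 <= \prod_(i < n) P i (dyadic_cell j k).
Proof. by apply: prode_ge0 => i _. Qed.

Let term_ge0 k A :
  0 <= (\prod_(i < n) P i (dyadic_cell j k)) * \d_(dyadic j k) A.
Proof. by rewrite mule_ge0. Qed.

Let dyadic_conflation0 : dyadic_conflation P j set0 = 0.
Proof. by apply: esum1 => k _; rewrite measure0 mule0. Qed.

Let dyadic_conflation_ge0 A : 0 <= dyadic_conflation P j A.
Proof. exact: esum_ge0. Qed.

Let dyadic_conflation_sigma_additive :
  semi_sigma_additive (dyadic_conflation P j).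
Proof.
move=> F mF tF mUF.
suff -> : dyadic_conflation P j (\bigcup_m F m) =
    \sum_(0 <= m <oo) dyadic_conflation P j (F m).
  by apply: is_cvg_ereal_nneg_natsum => m _; exact: dyadic_conflation_ge0.
pose a (k : int) (m : nat) :=
  (\prod_(i < n) P i (dyadic_cell j k)) * \d_(dyadic j k) (F m).
have a0 k m : 0 <= a k m by exact: term_ge0.
transitivity (\esum_(k in [set: int]) \esum_(m in [set: nat]) a k m).
  apply: eq_esum => k _.
  rewrite -nneseries_esumT// /a.
  have /fineK <- : \prod_(i < n) P i (dyadic_cell j k) \is a fin_num.
    by apply: prode_fin_num => i _; apply: fin_num_measure; exact: measurable_itv.
  rewrite nneseriesZl//; congr (_ * _).
  exact: measure_semi_bigcup.
rewrite nneseries_esumT; last by move=> m; exact: dyadic_conflation_ge0.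
rewrite !esum_esum//.
rewrite (reindex_esum ([set: nat] `*`` (fun=> [set: int])) _
  (fun x : nat * int => (x.2, x.1)))//=.
split=> [[]//|[m k] [m' k'] _ _ [-> ->]//|[k m] _].
by exists (m, k).
Qed.

HB.instance Definition _ := isMeasure.Build _ _ _ (dyadic_conflation P j)
  dyadic_conflation0 dyadic_conflation_ge0 dyadic_conflation_sigma_additive.

End dyadic_conflation_measure.

Definition vanishes_at_infinity (f : R -> R) :=
  f x @[x --> +oo] --> 0 /\ f x @[x --> -oo] --> 0.

Definition vague_cvg (nu : nat -> {measure set (measurableTypeR R) -> \bar R})
    (mu : {measure set (measurableTypeR R) -> \bar R}) :=
  forall f : R -> R, continuous f -> vanishes_at_infinity f ->
    (\int[nu j]_x (f x)%:E @[j --> \oo] --> \int[mu]_x (f x)%:E)%E.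

(** The bounds on the total mass are what makes the quotient meaningful;
    [mnormalize] returns its second argument, here the dummy [point], when
    they fail. *)
Definition is_conflation P Q :=
  (forall j, 0 < dyadic_conflation P j setT < +oo)%E /\
  vague_cvg (fun j => mnormalize (dyadic_conflation P j) point) Q.

(** Equal to the default value [point] when there is no conflation. *)
Definition conflation P : prob := get (is_conflation P).

End conflation.

Section mean.
Context {R : realType}.
Implicit Types Q : probability (measurableTypeR R) R.

Definition has_mean Q := Q.-integrable [set: R] (fun x : R => x%:E).

Definition mean Q : R := \int[Q]_x x.

End mean.

(** * Estimators *)

Definition mutually_independent {d : measure_display} {T : measurableType d}
    {R : realType} (P : probability T R) {n : nat} (X : 'I_n -> T -> R) :=
  forall (J : {set 'I_n}) (B : 'I_n -> set R), (forall i, measurable (B i)) ->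
    P (\bigcap_(i in [set` J]) (X i @^-1` B i)) =
    (\prod_(i in J) P (X i @^-1` B i))%E.

(** The unknown parameter ranges over [Par], and [P theta] is the law on the
    sample space when its value is [theta]; estimators are functions on the
    sample space, so they may not depend on [theta]. *)
Section estimators.
Context {d : measure_display} {T : measurableType d} {R : realType}.
Variables (Par : set R) (P : R -> probability T R).

(** For a measurable [Y] this includes integrability, as the expectation of a
    non-integrable [Y] is infinite ([+oo - +oo] is [-oo] in [\bar R]). *)
Definition unbiased (Y : T -> R) :=
  forall theta, Par theta -> ('E_(P theta)[Y] = theta%:E)%E.

Definition linear_estimator {n : nat} (X : 'I_n -> T -> R) (Y : T -> R) :=
  exists a : 'I_n -> R, forall w, Y w = \sum_(i < n) a i * X i w.

Definition is_BLUE {n : nat} (X : 'I_n -> T -> R) (Y : T -> R) :=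
  [/\ linear_estimator X Y, unbiased Y &
      forall Z, linear_estimator X Z -> unbiased Z ->
        forall theta, Par theta -> ('V_(P theta)[Y] <= 'V_(P theta)[Z])%E].

End estimators.

(* Main.v *)
Require Import Defs.
From HB Require Import structures.
From mathcomp Require Import all_boot all_order all_algebra.
From mathcomp Require Import all_classical all_reals all_analysis.
From mathcomp Require Import measurable_realfun ring lra.

Import Order.TTheory GRing.Theory Num.Theory.
Import numFieldNormedType.Exports.

Local Open Scope classical_set_scope.
Local Open Scope ring_scope.

(** The product of the Gaussian densities with means [x i] and standard
    deviations [s i] is, after completing the square, a constant times the
    Gaussian density whose mean is the average of the [x i] with weights
    proportional to [s i ^- 2] ([prod_normal_pdf]).  Hence the mean of the
    conflation is the classical inverse-variance weighted average
    ([mean_conflation_normal]), and the theorem splits into two independent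
    parts.

    The conflation of distributions with densities [phi i] is the distribution
    with density proportional to [\prod_i phi i] ([is_conflation_density]).
    The masses [P i C] of a dyadic cell [C] of length [2 ^- j], multiplied by
    [2 ^+ j], are the averages of [phi i] over [C], and these tend to [phi i]
    pointwise by continuity.  So the integral of [f] against the unnormalized
    dyadic conflation is, up to a factor depending on [j] only, the Lebesgue
    integral of a step function which tends to [f * \prod_i phi i].  Dominated
    convergence applies: the averages of all but one of the densities are
    bounded by constants, and a Gaussian average is bounded by a multiple of a
    wider Gaussian ([normal_fun_shift_le]).  The unknown factor cancels in the
    normalization.  Conversely, a vague limit is unique among probability
    measures, since continuous functions vanishing at infinity approximate the
    indicator functions of half-open intervals ([vague_limit_unique]); this
    identifies the conflation chosen by [get].  The mean of a normal
    distribution is found from its invariance under the reflection about its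
    center.

    For the statistical part, a nonzero value of the parameter forces the
    coefficients [b] of an unbiased linear estimator to add up to [1];
    independence makes the covariances vanish, by Fubini's theorem, so that
    the variance is [\sum_i b i ^+ 2 * s i ^+ 2].  This exceeds the value at
    the inverse-variance weights [a] by
    [\sum_i (b i - a i) ^+ 2 * s i ^+ 2] ([sum_sqr_weightE]), which gives both
    optimality and uniqueness. *)

(** * Linear combinations of independent random variables *)

(** The joint law of two independent variables is the product of their laws,
    and Fubini's theorem applies. *)
Lemma expectation_mul_independent {R : realType} {d} {T : measurableType d}
    (P : probability T R) (X Y : {mfun T >-> R}) :
  (forall A B : set R, measurable A -> measurable B ->
    P (X @^-1` A `&` Y @^-1` B) = (P (X @^-1` A) * P (Y @^-1` B))%E) ->
  (X : T -> R) \in Lfun P 1 -> (Y : T -> R) \in Lfun P 1 ->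
  ((X : T -> R) * Y)%R \in Lfun P 1 ->
  ('E_P[(X : T -> R) * Y] = 'E_P[X] * 'E_P[Y])%E.
Proof.
move=> indXY iX iY iXY.
have eX := expectation_fin_num iX; have eY := expectation_fin_num iY.
move: iX iY => /Lfun1_integrable iX /Lfun1_integrable iY.
move: iXY => /Lfun1_integrable iXY.
pose XY (w : T) : R * R := (X w, Y w).
have mXY : measurable_fun setT XY by exact/measurable_fun_pair.
(* [XY] bundled with its measurability, so that its law is a measure *)
pose XY' : {mfun T >-> (R * R)%type} :=
  HB.pack XY (isMeasurableFun.Build _ _ _ _ _ mXY).
pose f (z : R * R) : \bar R := (z.1 * z.2)%:E.
have mf : measurable_fun [set: R * R] f.
  exact/measurable_EFinP/measurable_funM.
pose mu1 : probability _ R := distribution P X.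
pose mu2 : probability _ R := distribution P Y.
pose mu := pushforward P XY'.
have eqm (A : set (R * R)) : measurable A -> (mu1 \x mu2)%E A = mu A.
  move=> mA; apply: (@product_measure_unique _ _ _ _ _ mu1 mu2
    mu) => // B C mB mC.
have ifp : mu.-integrable [set: R * R] f by exact: integrable_pushforward.
have ifm : (mu1 \x mu2)%E.-integrable [set: R * R] f.
  apply/integrableP; split => //.
  rewrite (eq_measure_integral mu) => [|? ? _]; last exact: eqm.
  by case/integrableP : ifp.
have mean1 : (\int[mu1]_x x%:E = 'E_P[X])%E.
  by rewrite unlock integral_pushforward.
have mean2 : (\int[mu2]_x x%:E = 'E_P[Y])%E.
  by rewrite unlock integral_pushforward.
have i2 : mu2.-integrable [set: R] EFin.
  by apply: integrable_pushforward => //; exact/measurable_EFinP.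
have i1 : mu1.-integrable [set: R] EFin.
  by apply: integrable_pushforward => //; exact/measurable_EFinP.
transitivity (\int[mu]_z f z)%E.
  by rewrite unlock integral_pushforward.
rewrite (eq_measure_integral (mu1 \x mu2)%E) => [|? ? _]; last exact/esym/eqm.
rewrite -integral12_prod_meas1// /fubini_F /f/=.
transitivity (\int[mu1]_x (x%:E * 'E_P[Y]))%E.
  apply: eq_integral => x _; under eq_integral do rewrite EFinM.
  by rewrite integralZl// mean2.
by rewrite -(fineK eY) integralZr// mean1 fineK.
Qed.

Lemma independent_covariance0 {R : realType} {d} {T : measurableType d}
    (P : probability T R) (n : nat) (X : 'I_n -> {mfun T >-> R}) (i j : 'I_n) :
  mutually_independent P X -> i != j ->
  (X i : T -> R) \in Lfun P 2%:E -> (X j : T -> R) \in Lfun P 2%:E ->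
  covariance P (X i) (X j) = 0%E.
Proof.
move=> indX ij Xi2 Xj2.
have Pfin : P setT \is a fin_num := fin_num_measure P _ measurableT.
have Xi1 := Lfun_subset12 Pfin Xi2.
have Xj1 := Lfun_subset12 Pfin Xj2.
have XX1 := Lfun2_mul_Lfun1 Xi2 Xj2.
rewrite covarianceE// expectation_mul_independent//.
  by rewrite subee// fin_numM ?expectation_fin_num.
move=> A B mA mB.
have := indX [set i; j]%SET (fun k => if k == i then A else B).
have -> : \bigcap_(k in [set` [set i; j]%SET])
    (X k @^-1` (if k == i then A else B)) = X i @^-1` A `&` X j @^-1` B.
  apply/seteqP; split => w /=.
    move=> Xw; split; first by have := Xw i; rewrite /= !inE eqxx; exact.
    by have := Xw j; rewrite /= !inE eqxx orbT eq_sym (negbTE ij); exact.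
  move=> [Xi Xj] k /=; rewrite !inE; have [->//|_ /= /eqP->//] := eqVneq k i.
rewrite big_setU1/= ?inE// big_set1 eqxx eq_sym (negbTE ij); apply.
by move=> k; case: ifP.
Qed.

(** A random variable with finite mean and finite variance is square
    integrable. *)
Lemma variance_fin_num_Lfun2 {R : realType} {d} {T : measurableType d}
    (P : probability T R) (X : {mfun T >-> R}) :
  'V_P[X] \is a fin_num -> (X : T -> R) \in Lfun P 2%:E.
Proof.
move=> fV; set c := fine 'E_P[X].
suff Xc : (X \- cst c : T -> R)%R \in Lfun P 2%:E.
  have -> : (X : T -> R) = ((X \- cst c) \+ cst c)%R.
    by apply/funext => w /=; rewrite subrK.
  have p1 : (1 <= 2%:E :> \bar R)%E by rewrite lee1n.
  by have [_] := Lfun_addr_closed P p1; apply => //; exact: Lfun_cst.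
have mXc : measurable_fun setT (X \- cst c : T -> R)%R.
  exact: measurable_funB.
rewrite inE; apply/andP; split; rewrite inE//=.
rewrite /finite_norm unlock poweR_lty//.
move: fV; rewrite /variance unlock unlock -/c => /fin_numPlt/andP[_].
congr (_ < _)%E; apply: eq_integral => w _ /=.
by rewrite powR_mulrn// real_normK ?num_real// expr2 /c unlock.
Qed.

Section linear_combination.
Context {R : realType} {d} {T : measurableType d} (P : probability T R).
Context {n : nat} (X : 'I_n -> {mfun T >-> R}).
Implicit Types (a : 'I_n -> R) (s : seq 'I_n) (Y : T -> R).

Let Pfin : P setT \is a fin_num := fin_num_measure P _ measurableT.

Let scale_consE a i s : (fun w => \sum_(k <- i :: s) a k * X k w) =
  (a i \o* X i \+ (fun w => \sum_(k <- s) a k * X k w))%R.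
Proof. by apply/funext => w /=; rewrite big_cons mulrC. Qed.

Let scale_nilE a : (fun w => \sum_(k <- [::]) a k * X k w) = cst 0.
Proof. by apply/funext => w; rewrite big_nil. Qed.

Lemma Lfun_lincomb p a s : (1 <= p)%R ->
  (forall i, (X i : T -> R) \in Lfun P p%:E) ->
  (fun w => \sum_(k <- s) a k * X k w) \in Lfun P p%:E.
Proof.
move=> p1 XL; have p1E : (1 <= p%:E)%E by rewrite lee_fin.
elim: s => [|i s IHs]; first by rewrite scale_nilE; exact: Lfun_cst.
rewrite scale_consE.
by have [_] := Lfun_addr_closed P p1E; apply => //; exact: Lfun_scale.
Qed.

Lemma expectation_lincomb a s :
  (forall i, (X i : T -> R) \in Lfun P 1) ->
  ('E_P[fun w => (\sum_(k <- s) a k * X k w)%R] =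
   \sum_(k <- s) ((a k)%:E * 'E_P[X k]))%E.
Proof.
move=> X1; elim: s => [|i s IHs].
  by rewrite scale_nilE expectation_cst big_nil.
rewrite scale_consE expectationD ?IHs ?big_cons ?expectationZl//.
  exact: Lfun_scale.
exact: Lfun_lincomb.
Qed.

Lemma covariance_lincombl a s Y :
  (forall i, (X i : T -> R) \in Lfun P 2%:E) -> Y \in Lfun P 2%:E ->
  (covariance P (fun w => (\sum_(k <- s) a k * X k w)%R) Y =
   \sum_(k <- s) ((a k)%:E * covariance P (X k) Y))%E.
Proof.
move=> X2 Y2; elim: s => [|i s IHs].
  by rewrite scale_nilE covariance_cst_l big_nil.
rewrite scale_consE covarianceDl//; last 2 first.
- exact/Lfun_scale/X2/ler1n.
- exact/Lfun_lincomb/X2/ler1n.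
rewrite covarianceZl ?IHs ?big_cons//; last exact: Lfun2_mul_Lfun1.
- exact: (Lfun_subset12 Pfin).
- exact: (Lfun_subset12 Pfin).
Qed.

(** Variances of independent square integrable variables add up. *)
Lemma variance_lincomb_independent a :
  mutually_independent P X -> (forall i, (X i : T -> R) \in Lfun P 2%:E) ->
  ('V_P[fun w => (\sum_(i < n) a i * X i w)%R] =
   \sum_(i < n) ((a i ^+ 2)%:E * 'V_P[X i]))%E.
Proof.
move=> indX X2.
have L2 : (fun w => \sum_(i < n) a i * X i w) \in Lfun P 2%:E.
  exact/Lfun_lincomb/X2/ler1n.
rewrite /variance covariance_lincombl//; apply: eq_bigr => i _.
rewrite covarianceC covariance_lincombl//.
rewrite (bigD1 i)//= big1 ?adde0 => [|k ki]; last first.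
  by rewrite (independent_covariance0 _ _ _ _ _ indX) ?mule0.
by rewrite muleA -EFinM -expr2.
Qed.

End linear_combination.

(** * The weights minimizing the variance *)

(** The precision of a distribution is the inverse of its variance; this is
    the total precision for the standard deviations [s]. *)
Definition precision {R : realType} {n} (s : 'I_n -> R) : R :=
  \sum_(i < n) (s i ^+ 2)^-1.

(** The weights adding up to [1] which are inversely proportional to the
    variances. *)
Definition precision_weight {R : realType} {n} (s : 'I_n -> R) (i : 'I_n) : R :=
  (s i ^+ 2)^-1 / precision s.

Section precision_theory.
Context {R : realType} {n : nat} (s : 'I_n -> R).
Hypothesis (n_gt0 : (0 < n)%N) (s_gt0 : forall i, 0 < s i).

Lemma precision_gt0 : 0 < precision s.
Proof.
rewrite /precision (bigD1 (Ordinal n_gt0))//= ltr_pwDl ?invr_gt0 ?exprn_gt0//.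
by apply: sumr_ge0 => i _; rewrite invr_ge0 exprn_ge0// ltW.
Qed.

Lemma sum_precision_weight : \sum_(i < n) precision_weight s i = 1.
Proof. by rewrite -mulr_suml divff// gt_eqF// precision_gt0. Qed.

(** The excess of the variance of an affine combination over the minimum is a
    weighted sum of squares; this gives optimality and uniqueness at once. *)
Lemma sum_sqr_weightE (b : 'I_n -> R) : \sum_(i < n) b i = 1 ->
  \sum_(i < n) b i ^+ 2 * s i ^+ 2 =
  \sum_(i < n) precision_weight s i ^+ 2 * s i ^+ 2 +
  \sum_(i < n) (b i - precision_weight s i) ^+ 2 * s i ^+ 2.
Proof.
move=> b1.
have tau0 : precision s != 0 by rewrite gt_eqF// precision_gt0.
have s0 i : s i != 0 by rewrite gt_eqF.
(* the cross terms of the square: [precision_weight s i * s i ^+ 2] does not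
   depend on [i], and both families of weights have sum [1] *)
have : \sum_(i < n) (b i - precision_weight s i) * (2 / precision s) = 0.
  by rewrite -mulr_suml sumrB b1 sum_precision_weight subrr mul0r.
move=> cross; rewrite -[RHS]addr0; rewrite -[X in _ = _ + X]cross -!big_split/=.
apply: eq_bigr => i _; rewrite /precision_weight.
by field; rewrite tau0 s0.
Qed.

End precision_theory.

(** * The best linear unbiased estimator *)

Section precision_weighted_BLUE.
Context {R : realType} {d} {T : measurableType d} {n : nat}.
Variables (Par : set R) (P : R -> probability T R).
Variables (X : 'I_n -> {mfun T >-> R}) (s : 'I_n -> R).
Hypothesis n_gt0 : (0 < n)%N.
Hypothesis Par_neq0 : exists2 theta, Par theta & theta != 0.
Hypothesis indX : forall theta, Par theta -> mutually_independent (P theta) X.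
Hypothesis unbiasedX : forall i, unbiased Par P (X i).
Hypothesis s_gt0 : forall i, 0 < s i.
Hypothesis varX : forall theta, Par theta ->
  forall i, ('V_(P theta)[X i] = (s i ^+ 2)%:E)%E.

Let X_Lfun2 theta i : Par theta -> (X i : T -> R) \in Lfun (P theta) 2%:E.
Proof. by move=> /varX V; apply: variance_fin_num_Lfun2; rewrite V. Qed.

Lemma expectation_linear_estimator (b : 'I_n -> R) theta : Par theta ->
  ('E_(P theta)[fun w => (\sum_(i < n) b i * X i w)%R] =
   ((\sum_(i < n) b i) * theta)%:E)%E.
Proof.
move=> Pt; rewrite expectation_lincomb => [|i]; last first.
  by apply/Lfun_subset12/X_Lfun2 => //; exact: fin_num_measure.
rewrite mulr_suml -sumEFin; apply: eq_bigr => i _.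
by rewrite unbiasedX.
Qed.

(** A nonzero value of the parameter forces the coefficients of an unbiased
    linear estimator to add up to [1]. *)
Lemma unbiased_linear_estimator (b : 'I_n -> R) :
  unbiased Par P (fun w => \sum_(i < n) b i * X i w) <-> \sum_(i < n) b i = 1.
Proof.
split=> [ub|b1 theta Pt]; last first.
  by rewrite expectation_linear_estimator// b1 mul1r.
have [theta Pt t0] := Par_neq0.
have := expectation_linear_estimator b _ Pt.
by rewrite ub// => -[tE]; apply: (mulIf t0); rewrite mul1r.
Qed.

Lemma variance_linear_estimator (b : 'I_n -> R) theta : Par theta ->
  ('V_(P theta)[fun w => (\sum_(i < n) b i * X i w)%R] =
   (\sum_(i < n) b i ^+ 2 * s i ^+ 2)%:E)%E.
Proof.
move=> Pt; rewrite variance_lincomb_independent//; last 2 first.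
- exact: indX.
- by move=> i; exact: X_Lfun2.
by rewrite -sumEFin; apply: eq_bigr => i _; rewrite varX.
Qed.

(** The average of the estimators with inverse-variance weights. *)
Definition precision_mean (w : T) := \sum_(i < n) precision_weight s i * X i w.

Lemma precision_mean_BLUE : is_BLUE Par P X precision_mean.
Proof.
split; first by exists (precision_weight s).
  exact/unbiased_linear_estimator/sum_precision_weight.
move=> Z [b /funext ->] /unbiased_linear_estimator b1 theta Pt.
rewrite !variance_linear_estimator// lee_fin (sum_sqr_weightE _ _ _ _ b1)//.
rewrite lerDl; apply: sumr_ge0 => i _.
by rewrite mulr_ge0// sqr_ge0.
Qed.

Lemma BLUE_unique (Z : T -> R) : is_BLUE Par P X Z -> Z = precision_mean.
Proof.
case=> -[b /funext ->] /unbiased_linear_estimator b1 optZ.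
have [theta Pt _] := Par_neq0.
have [linM unbM _] := precision_mean_BLUE.
have := optZ _ linM unbM _ Pt.
rewrite !variance_linear_estimator// lee_fin (sum_sqr_weightE _ _ _ _ b1)//.
rewrite gerDl => le0.
apply/funext => w; apply: eq_bigr => i _; congr (_ * _).
have ge0 k : 0 <= (b k - precision_weight s k) ^+ 2 * s k ^+ 2.
  by rewrite mulr_ge0// sqr_ge0.
have /eqP : \sum_(k < n) (b k - precision_weight s k) ^+ 2 * s k ^+ 2 = 0.
  by apply/eqP; rewrite eq_le le0 sumr_ge0.
rewrite psumr_eq0// => /allP/(_ i); rewrite mem_index_enum => /(_ isT).
by rewrite mulf_eq0 !expf_eq0/= (gt_eqF (s_gt0 i)) orbF subr_eq0 => /eqP.
Qed.

End precision_weighted_BLUE.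

(** * Uniqueness of vague limits *)

(** The continuous ramp from [0] (left of [0]) to [1] (right of [1]). *)
Definition ramp {R : realType} (x : R) : R := (`|x| - `|x - 1| + 1) / 2.

Section ramp_theory.
Context {R : realType}.
Implicit Types x a b : R.

Lemma ramp_le0 x : x <= 0 -> ramp x = 0.
Proof.
move=> x0; rewrite /ramp ler0_norm// ler0_norm; last by lra.
by rewrite opprK addrA subrK; lra.
Qed.

Lemma ramp_ge1 x : 1 <= x -> ramp x = 1.
Proof.
move=> x1; rewrite /ramp ger0_norm; last by lra.
by rewrite ger0_norm; lra.
Qed.

Lemma ramp_ge0 x : 0 <= ramp x.
Proof.
have [x0|x0] := leP x 0; first by rewrite ramp_le0.
have [x1|x1] := leP 1 x; first by rewrite ramp_ge1.
by rewrite /ramp ger0_norm ?ltr0_norm; lra.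
Qed.

Lemma ramp_le1 x : ramp x <= 1.
Proof.
have [x0|x0] := leP x 0; first by rewrite ramp_le0.
have [x1|x1] := leP 1 x; first by rewrite ramp_ge1.
by rewrite /ramp ger0_norm ?ltr0_norm; lra.
Qed.

Lemma continuous_ramp : continuous (@ramp R).
Proof.
move=> x; apply: cvgM; last exact: cvg_cst.
apply: cvgD; last exact: cvg_cst.
apply: cvgB; first by apply: cvg_norm; exact: cvg_id.
by apply: cvg_norm; apply: cvgB; [exact: cvg_id|exact: cvg_cst].
Qed.

(** Continuous functions with compact support, tending pointwise to the
    indicator function of the interval from [a] excluded to [b] included, when
    [a <= b]. *)
Definition trapezoid a b (n : nat) x : R :=
  ramp (n%:R * (x - a)) - ramp (n%:R * (x - b)).

Lemma trapezoid_le1 a b n x : `|trapezoid a b n x| <= 1.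
Proof.
rewrite /trapezoid ler_norml.
have := ramp_ge0 (n%:R * (x - a)); have := ramp_le1 (n%:R * (x - a)).
have := ramp_ge0 (n%:R * (x - b)); have := ramp_le1 (n%:R * (x - b)).
lra.
Qed.

Lemma continuous_trapezoid a b n : continuous (trapezoid a b n).
Proof.
have cr c : continuous (fun x => ramp (n%:R * (x - c))).
  move=> x; apply: (@continuous_comp _ _ _ (fun x => n%:R * (x - c)) ramp).
    apply: cvgM; first exact: cvg_cst.
    by apply: cvgB; [exact: cvg_id|exact: cvg_cst].
  exact: continuous_ramp.
by move=> x; apply: cvgB; exact: cr.
Qed.

Let ramp_scaled_ge1 (n : nat) (c x : R) : (0 < n)%N -> c + 1 <= x ->
  ramp (n%:R * (x - c)) = 1.
Proof.
move=> n0 cx; rewrite ramp_ge1//.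
have : 1 <= n%:R :> R by rewrite ler1n.
nra.
Qed.

Let ramp_scaled_le0 (n : nat) (c x : R) : x <= c -> ramp (n%:R * (x - c)) = 0.
Proof.
by move=> cx; rewrite ramp_le0// mulr_ge0_le0 ?subr_le0.
Qed.

Lemma trapezoid_vanishes a b n : vanishes_at_infinity (trapezoid a b n).
Proof.
case: n => [|n].
  (* the ramps degenerate to a constant for [n = 0] *)
  rewrite (_ : trapezoid a b 0 = cst 0); last first.
    by apply/funext => x; rewrite /trapezoid !mul0r subrr.
  by split; exact: cvg_cst.
split; apply: cvg_near_cst; near=> x; rewrite /trapezoid.
- rewrite !ramp_scaled_ge1 ?subrr//; near: x; exact: nbhs_pinfty_ge.
- rewrite !ramp_scaled_le0 ?subrr//; near: x; exact: nbhs_ninfty_le.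
Unshelve. all: by end_near. Qed.

Lemma trapezoid_cvg a b x : a <= b ->
  trapezoid a b n x @[n --> \oo] --> (\1_(`]a, b]%classic : set R) x : R).
Proof.
have ramp1 c : c < x -> \forall n \near \oo, ramp (n%:R * (x - c)) = 1.
  move=> cx; near=> n; rewrite ramp_ge1//.
  rewrite -ler_pdivrMr ?subr_gt0// div1r.
  near: n; exact: nbhs_infty_ger.
move=> ab; apply: cvg_near_cst.
rewrite indicE; have [xa|ax] := leP x a.
  rewrite memNset/=; last by rewrite in_itv/= ltNge xa.
  by near=> n; rewrite /trapezoid !ramp_scaled_le0 ?subrr// (le_trans xa).
have [xb|bx] := leP x b.
  rewrite mem_set/=; last by rewrite in_itv/= ax.
  near=> n; rewrite /trapezoid (ramp_scaled_le0 _ _ _ xb) subr0.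
  by near: n; exact: ramp1.
rewrite memNset/=; last by rewrite in_itv/= ax/= leNgt bx.
near=> n; rewrite /trapezoid.
have -> : ramp (n%:R * (x - a)) = 1 by near: n; exact: ramp1.
have -> : ramp (n%:R * (x - b)) = 1 by near: n; exact: ramp1.
by rewrite subrr.
Unshelve. all: by end_near. Qed.

End ramp_theory.

Section vague_limit_unique.
Context {R : realType}.
Implicit Types Q : probability (measurableTypeR R) R.
Local Open Scope ereal_scope.

Lemma integral_trapezoid_cvg Q (a b : R) : (a <= b)%R ->
  \int[Q]_x (trapezoid a b n x)%:E @[n --> \oo] --> Q `]a, b]%classic.
Proof.
move=> ab.
have -> : Q `]a, b]%classic = \int[Q]_x (\1_(`]a, b]%classic : set R) x)%:E.
  by rewrite integral_indic//; congr (Q _); exact/esym/setIT.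
have mt n : measurable_fun [set: measurableTypeR R] (trapezoid a b n).
  exact (continuous_measurable_fun (continuous_trapezoid a b n)).
apply: (@dominated_cvg _ _ _ Q _ _ _ _ (cst 1)) => //.
- by move=> n; apply/measurable_EFinP; exact: mt.
- move=> x _; apply: cvg_EFin; first by near=> n.
  exact: trapezoid_cvg.
- exact: finite_measure_integrable_cst.
- by move=> n x _; rewrite lee_fin; exact: trapezoid_le1.
Unshelve. all: by end_near. Qed.

(** Continuous functions vanishing at infinity separate probability
    measures. *)
Lemma eq_probability_C0 Q1 Q2 :
  (forall f : R -> R, continuous f -> vanishes_at_infinity f ->
    \int[Q1]_x (f x)%:E = \int[Q2]_x (f x)%:E) ->
  forall A, measurable A -> Q1 A = Q2 A.
Proof.
move=> Q12 A mA.
apply: (@measure_unique _ R (measurableTypeR R) (@ocitv R)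
  (fun k => `](- k%:R)%R, k%:R]%classic) _ _ _ _ Q1 Q2) => //.
- exact: ocitvI.
- by move=> k; exact: is_ocitv.
- apply/seteqP; split => // x _; exists (Num.trunc `|x : R|).+1 => //=.
  have := truncnS_gt `|x : R|.
  by rewrite ltr_norml in_itv/= => /andP[-> /ltW].
- move=> _ [[a b] _ <-]/=.
  have [ab|ba] := leP a b; last first.
    by rewrite set_itv_ge ?measure0// bnd_simp -leNgt ltW.
  apply: cvg_unique (integral_trapezoid_cvg Q2 _ _ ab) => //=.
  have -> : (fun n => \int[Q2]_x (trapezoid a b n x)%:E) =
            (fun n => \int[Q1]_x (trapezoid a b n x)%:E).
    apply/funext => n; apply/esym/Q12; first exact: continuous_trapezoid.
    exact: trapezoid_vanishes.
  exact: integral_trapezoid_cvg.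
- by move=> k; rewrite (le_lt_trans (probability_le1 _ _)) ?ltry.
Qed.

Lemma vague_limit_unique
    (nu : nat -> {measure set (measurableTypeR R) -> \bar R}) Q1 Q2 :
  vague_cvg nu Q1 -> vague_cvg nu Q2 ->
  forall A, measurable A -> Q1 A = Q2 A.
Proof.
move=> nu1 nu2; apply: eq_probability_C0 => f cf f0.
by apply: cvg_unique (nu1 f cf f0) (nu2 f cf f0).
Qed.

End vague_limit_unique.

(** * Dyadic discretization *)

(** A bijection from the natural numbers onto the integers, to turn sums over
    the integers into series. *)
Definition int_enum (m : nat) : int := if odd m then Negz m./2 else Posz m./2.

Lemma int_enum_bij : set_bij [set: nat] [set: int] int_enum.
Proof.
split=> // [m p _ _|[k|k] _]; last 2 first.
- by exists k.*2 => //; rewrite /int_enum odd_double doubleK.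
- by exists k.*2.+1 => //; rewrite /int_enum/= odd_double/= uphalf_double.
rewrite /int_enum => e; rewrite -[m]odd_double_half -[p]odd_double_half.
by move: e; case: (odd m); case: (odd p) => // -[->].
Qed.

Lemma esum_int {R : realType} (a : int -> \bar R) : (forall k, 0 <= a k)%E ->
  (\esum_(k in [set: int]) a k = \sum_(m <oo) a (int_enum m))%E.
Proof.
by move=> a0; rewrite (reindex_esum _ _ _ _ int_enum_bij) nneseries_esumT.
Qed.

Section dyadic_cells.
Context {R : realType}.
Implicit Types (x y : R) (j : nat) (k : int).

(** The index of the dyadic cell of order [j] to which [x] belongs. *)
Definition dyadic_index j x : int := Num.ceil (x * 2 ^+ j).

Let pow2_gt0 j : 0 < 2 ^+ j :> R. Proof. exact: exprn_gt0. Qed.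

Lemma dyadic_cellE j k x : dyadic_cell j k x <-> dyadic_index j x = k.
Proof.
rewrite /dyadic_cell /dyadic_index /dyadic/= in_itv/=.
rewrite ltr_pdivrMr// ler_pdivlMr// -ceil_eq.
by split => [/eqP|->].
Qed.

Lemma mem_dyadic_cell j x : dyadic_cell j (dyadic_index j x) x.
Proof. exact/dyadic_cellE. Qed.

Lemma dyadic_cell_width j k : dyadic j k - dyadic j (k - 1) = 2 ^- j :> R.
Proof. by rewrite /dyadic -mulrBl intrB opprB addrC subrK mul1r. Qed.

Lemma lebesgue_measure_dyadic_cell j k :
  lebesgue_measure (dyadic_cell j k : set R) = (2 ^- j)%:E.
Proof.
rewrite /dyadic_cell lebesgue_measure_itv/= lte_fin.
have := dyadic_cell_width j k; have : 0 < 2 ^- j :> R by rewrite invr_gt0.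
move=> w_gt0 wE; case: ltP => [_|kk]; first by rewrite -wE EFinB.
by exfalso; lra.
Qed.

Lemma dyadic_cell_dist j k x y :
  dyadic_cell j k x -> dyadic_cell j k y -> `|x - y| <= 2 ^- j.
Proof.
rewrite /dyadic_cell/= !in_itv/= => /andP[x1 x2] /andP[y1 y2].
have := dyadic_cell_width j k.
by rewrite ler_norml; lra.
Qed.

Lemma mem_dyadic_cell_dyadic j k : dyadic_cell j k (dyadic j k : R).
Proof.
rewrite /dyadic_cell/= in_itv/= lexx andbT.
have := dyadic_cell_width j k; have : 0 < 2 ^- j :> R by rewrite invr_gt0.
lra.
Qed.

Lemma exp2N_le1 j : 2 ^- j <= 1 :> R.
Proof. by rewrite invf_le1// exprn_ege1// ler1n. Qed.

Lemma bigcup_dyadic_cell j :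
  \bigcup_m dyadic_cell j (int_enum m) = [set: R].
Proof.
apply/seteqP; split=> // x _.
have [_ _ /(_ (dyadic_index j x) I)[m _ mE]] := int_enum_bij.
by exists m => //; rewrite mE; exact: mem_dyadic_cell.
Qed.

Lemma trivIset_dyadic_cell j :
  trivIset [set: nat] (fun m => dyadic_cell j (int_enum m) : set R).
Proof.
apply/trivIsetP => m p _ _ mp; apply/seteqP; split=> // x [].
move=> /dyadic_cellE mE /dyadic_cellE; rewrite mE.
have [_ inj _] := int_enum_bij.
by move=> /inj mpE; move: mp; rewrite mpE ?inE ?eqxx.
Qed.

Lemma measurable_fun_dyadic_index {d} {T : measurableType d} j (h : int -> T) :
  measurable_fun [set: R] (fun x => h (dyadic_index j x)).
Proof.
move=> _ Y mY; rewrite setTI.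
have -> : (fun x => h (dyadic_index j x)) @^-1` Y =
    \bigcup_(m in [set m | Y (h (int_enum m))]) dyadic_cell j (int_enum m).
  apply/seteqP; split => x /=.
    have [_ _ /(_ (dyadic_index j x) I)[m _ mE]] := int_enum_bij.
    by move=> Yx; exists m; rewrite /= mE//; exact: mem_dyadic_cell.
  by move=> [m /= Ym /dyadic_cellE ->].
by apply: bigcup_measurable => m _; exact: measurable_itv.
Qed.

Lemma integral_dyadic_step j (h : int -> R) : (forall k, 0 <= h k) ->
  (\int[lebesgue_measure]_x (h (dyadic_index j x))%:E =
   \sum_(m <oo) (h (int_enum m) * 2 ^- j)%:E)%E.
Proof.
move=> h0; rewrite -[X in integral _ X _](bigcup_dyadic_cell j).
rewrite ge0_integral_bigcup.
- apply: eq_eseriesr => m _.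
  transitivity (\int[lebesgue_measure]_(x in dyadic_cell j (int_enum m))
      (cst (h (int_enum m))%:E x))%E.
    by apply: eq_integral => x; rewrite inE => /dyadic_cellE ->.
  rewrite integral_cst; last exact: measurable_itv.
  by rewrite [X in (_ * X)%E]lebesgue_measure_dyadic_cell EFinM.
- by move=> m; exact: measurable_itv.
- apply/measurable_EFinP; rewrite bigcup_dyadic_cell.
  exact: measurable_fun_dyadic_index.
- by move=> x _; rewrite lee_fin.
- exact: trivIset_dyadic_cell.
Qed.

End dyadic_cells.

Section dyadic_conflation_integral.
Context {R : realType} {n : nat}.
Variable P : 'I_n -> probability (measurableTypeR R) R.
Local Open Scope ereal_scope.

(** The mass which the dyadic conflation puts on [dyadic j k]. *)
Definition dyadic_weight j k : R :=
  (\prod_(i < n) fine (P i (dyadic_cell j k)))%R.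

Lemma dyadic_weight_ge0 j k : (0 <= dyadic_weight j k)%R.
Proof. by apply: prodr_ge0 => i _; rewrite fine_ge0. Qed.

Lemma dyadic_conflationE j A :
  dyadic_conflation P j A =
  \sum_(m <oo)
    ((dyadic_weight j (int_enum m))%:E * \d_(dyadic j (int_enum m)) A).
Proof.
rewrite /dyadic_conflation.
transitivity (\esum_(k in [set: int])
    ((dyadic_weight j k)%:E * \d_(dyadic j k : measurableTypeR R) A)).
  apply: eq_esum => k _; congr (_ * _).
  rewrite /dyadic_weight -prodEFin; apply: eq_bigr => i _.
  by rewrite fineK// fin_num_measure//; exact: measurable_itv.
by rewrite esum_int// => k; rewrite mule_ge0// lee_fin dyadic_weight_ge0.
Qed.

Lemma ge0_integral_dyadic_conflation j (f : R -> R) :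
  (forall x, 0 <= f x)%R -> measurable_fun [set: R] f ->
  \int[dyadic_conflation P j]_x (f x)%:E =
  \sum_(m <oo) (dyadic_weight j (int_enum m) * f (dyadic j (int_enum m)))%:E.
Proof.
move=> f0 mf.
have mfE : measurable_fun [set: measurableTypeR R] (EFin \o f).
  by apply/measurable_EFinP; exact mf.
pose m_ m : {measure set (measurableTypeR R) -> \bar R} :=
  mscale (NngNum (dyadic_weight_ge0 j (int_enum m)))
         (\d_(dyadic j (int_enum m) : measurableTypeR R)).
rewrite (eq_measure_integral (mseries m_ 0)) => [|A mA _]; last first.
  exact: dyadic_conflationE.
rewrite ge0_integral_measure_series//; last by move=> x _; rewrite lee_fin.
apply: eq_eseriesr => m _.
rewrite ge0_integral_mscale//; last by move=> x _; rewrite lee_fin.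
by rewrite integral_dirac// diracT mul1e EFinM.
Qed.

End dyadic_conflation_integral.

(** * Conflation of absolutely continuous distributions *)

Lemma continuous_vanishing_bounded {R : realType} (f : R -> R) :
  continuous f -> vanishes_at_infinity f -> exists C, forall x, `|f x| <= C.
Proof.
move=> cf [fy fNy].
have bnd (F : set_system R) : Filter F -> f x @[x --> F] --> (0 : R) ->
    \forall x \near F, `|f x| <= 1.
  move=> FF f0; near=> x; rewrite -[f x]subr0 distrC.
  by near: x; move/cvgrPdist_le : f0; apply.
have [a [_ fa]] := bnd _ _ fy.
have [b [_ fb]] := bnd _ _ fNy.
pose c := Num.max `|a| `|b|.
have c0 : - c <= c by rewrite ge0_cp// le_max normr_ge0.
have cn : {within `[- c, c], continuous (fun x => `|f x|)}.
  by apply: continuous_subspaceT => x; apply: cvg_norm; exact: cf.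
have [z _ zmax] := EVT_max c0 cn.
exists (Num.max 1 `|f z|) => x; rewrite le_max.
have [xa|ax] := ltP c x.
  rewrite fa//; apply: le_lt_trans xa.
  by rewrite (le_trans (ler_norm a))// le_max lexx.
have [xb|bx] := ltP x (- c).
  rewrite fb//; apply: (lt_le_trans xb).
  by rewrite lerNl (le_trans (ler_norm (- b)))// normrN le_max lexx orbT.
by rewrite zmax ?orbT// in_itv/= bx.
Unshelve. all: by end_near. Qed.

(** Integration against a probability measure given by a density. *)
Lemma ge0_integral_density {R : realType}
    (Q : probability (measurableTypeR R) R) (g : R -> R) (f : R -> \bar R) :
  (forall x, 0 <= g x) -> measurable_fun [set: R] g ->
  (forall A, measurable A ->
    Q A = (\int[lebesgue_measure]_(x in A) (g x)%:E)%E) ->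
  (forall x, (0 <= f x)%E) -> measurable_fun [set: R] f ->
  (\int[Q]_x f x = \int[lebesgue_measure]_x (f x * (g x)%:E))%E.
Proof.
move=> g0 mg Qg f0 mf.
have mgE : measurable_fun [set: measurableTypeR R] (EFin \o g).
  by apply/measurable_EFinP; exact mg.
have dom : Q `<< lebesgue_measure.
  apply/null_content_dominatesP => A mA A0; rewrite Qg//.
  by apply: null_set_integral => //; apply: measurable_funTS; exact mgE.
rewrite -(Radon_Nikodym_SigmaFinite.change_of_variables dom)//.
apply: ae_eq_integral => //.
- apply: emeasurable_funM; first exact mf.
  exact: measurable_int (Radon_Nikodym_SigmaFinite.f_integrable dom).
- by apply: emeasurable_funM; [exact mf|exact mgE].
- (* the density and the Radon-Nikodym derivative have the same integrals *)
  apply: ae_eqe_mul2l => /=.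
  apply: integral_ae_eq => //=.
  + exact: (Radon_Nikodym_SigmaFinite.f_integrable dom).
  + move=> A _ mA.
    by rewrite -(Radon_Nikodym_SigmaFinite.f_integral dom)//; exact: Qg.
Qed.

Section cell_average.
Context {R : realType}.
Variables (Q : probability (measurableTypeR R) R) (g : R -> R).
Hypothesis g_ge0 : forall x, 0 <= g x.
Hypothesis cg : continuous g.
Hypothesis Qg :
  forall A, measurable A -> Q A = (\int[lebesgue_measure]_(x in A) (g x)%:E)%E.

(** The mean value of the density [g] on the dyadic cell of [x]. *)
Definition cell_average j (x : R) : R :=
  2 ^+ j * fine (Q (dyadic_cell j (dyadic_index j x))).

Let pow2_gt0 j : 0 < 2 ^+ j :> R. Proof. exact: exprn_gt0. Qed.

Let mg : measurable_fun [set: measurableTypeR R] (EFin \o g).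
Proof.
by apply/measurable_EFinP; exact (continuous_measurable_fun cg).
Qed.

Let mcell j (k : int) : measurable (dyadic_cell j k : set (measurableTypeR R)).
Proof. exact: measurable_itv. Qed.

Let Q_cellK j (k : int) : (fine (Q (dyadic_cell j k)))%:E =
  (\int[lebesgue_measure]_(x in dyadic_cell j k) (g x)%:E)%E.
Proof. by rewrite -Qg// fineK// fin_num_measure. Qed.

Let integral_cst_cell j (k : int) (c : R) :
  (\int[lebesgue_measure]_(x in dyadic_cell j k) cst c%:E x =
   (c / 2 ^+ j)%:E)%E.
Proof.
rewrite integral_cst; last exact: mcell.
by rewrite [X in (_ * X)%E]lebesgue_measure_dyadic_cell EFinM.
Qed.

Lemma cell_average_le j x c :
  (forall y, `|x - y| <= 2 ^- j -> g y <= c) -> cell_average j x <= c.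
Proof.
move=> gc; rewrite /cell_average mulrC -ler_pdivlMr//.
rewrite -lee_fin Q_cellK -(integral_cst_cell _ (dyadic_index j x)).
apply: ge0_le_integral; first exact: mcell.
- by move=> y _; rewrite lee_fin.
- exact: measurable_funTS.
- exact: measurable_cst.
- move=> y xy; rewrite lee_fin gc//.
  exact: dyadic_cell_dist (mem_dyadic_cell j x) xy.
Qed.

Lemma cell_average_ge j x c : 0 <= c ->
  (forall y, `|x - y| <= 2 ^- j -> c <= g y) -> c <= cell_average j x.
Proof.
move=> c0 gc; rewrite /cell_average mulrC -ler_pdivrMr//.
rewrite -lee_fin Q_cellK -(integral_cst_cell _ (dyadic_index j x)).
apply: ge0_le_integral; first exact: mcell.
- by move=> y _; rewrite lee_fin.
- exact: measurable_cst.
- exact: measurable_funTS.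
- move=> y xy; rewrite lee_fin gc//.
  exact: dyadic_cell_dist (mem_dyadic_cell j x) xy.
Qed.

Lemma cell_average_ge0 j x : 0 <= cell_average j x.
Proof. by rewrite mulr_ge0 ?fine_ge0// ltW. Qed.

(** A continuous positive density has a positive lower bound on a cell. *)
Lemma cell_average_gt0 j x : (forall y, 0 < g y) -> 0 < cell_average j x.
Proof.
move=> g_gt0; have e0 : 0 < 2 ^- j :> R by rewrite invr_gt0.
have xx : x - 2 ^- j <= x + 2 ^- j by lra.
have [z _ zmin] := @EVT_min _ g _ _ xx (continuous_subspaceT cg).
apply: (lt_le_trans (g_gt0 z)); apply: cell_average_ge; first exact: ltW.
by move=> y; rewrite ler_norml => xy; apply: zmin; rewrite in_itv/=; lra.
Qed.

Lemma near_dyadic_dist (x e : R) : 0 < e ->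
  \forall j \near \oo, forall y, `|x - y| <= 2 ^- j -> `|x - y| < e.
Proof.
move=> e0; near=> j => y; move=> /le_lt_trans; apply.
near: j.
have : (2^-1 : R) ^+ j @[j --> \oo] --> (0 : R).
  by apply: cvg_expr; rewrite ger0_norm ?invr_ge0// invf_lt1// ltr1n.
move=> /cvgrPdist_lt/(_ e e0); apply: filterS => j.
by rewrite sub0r normrN exprVn ger0_norm// invr_ge0 ltW.
Unshelve. all: by end_near. Qed.

Lemma cell_average_cvg x : cell_average j x @[j --> \oo] --> g x.
Proof.
apply/cvgrPdist_le => e e0.
have /cvgrPdist_le/(_ e e0)/nbhs_ballP[d /= d0 dg] := cg x.
have := near_dyadic_dist x d d0; apply: filterS => j jd.
have gxy y : `|x - y| <= 2 ^- j -> `|g x - g y| <= e.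
  by move=> xy; apply: dg; exact: jd.
rewrite ler_distl; apply/andP; split.
  rewrite lerBlDr; apply: cell_average_le => y /gxy.
  by rewrite ler_distlC => /andP[].
rewrite -lerBlDr; have [ge0|lt0] := leP 0 (g x - e).
  by apply: cell_average_ge => // y /gxy; rewrite ler_distlC => /andP[].
exact: le_trans (ltW lt0) (cell_average_ge0 j x).
Qed.

End cell_average.

(** The right end points of the dyadic cells of [x] tend to [x]. *)
Lemma dyadic_index_cvg {R : realType} (x : R) :
  dyadic j (dyadic_index j x) @[j --> \oo] --> x.
Proof.
apply/cvgrPdist_lt => e e0.
have := near_dyadic_dist x e e0; apply: filterS => j; apply.
exact: dyadic_cell_dist (mem_dyadic_cell j x) (mem_dyadic_cell_dyadic _ _).
Qed.

(** Distributions with positive continuous bounded densities [phi i], one of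
    which, [phi i0], is dominated by an integrable function uniformly under
    translations by at most [1]. *)
Section conflation_density.
Context {R : realType} {n : nat}.
Variables (P : 'I_n -> probability (measurableTypeR R) R).
Variables (phi : 'I_n -> R -> R).
Hypothesis phi_gt0 : forall i x, 0 < phi i x.
Hypothesis cphi : forall i, continuous (phi i).
Hypothesis Pphi : forall i A, measurable A ->
  P i A = (\int[lebesgue_measure]_(x in A) (phi i x)%:E)%E.
Variables (M : 'I_n -> R) (i0 : 'I_n) (G : R -> R).
Hypothesis phi_le : forall i x, phi i x <= M i.
Hypothesis iG : lebesgue_measure.-integrable [set: R] (EFin \o G).
Hypothesis phi_leG : forall x y, `|x - y| <= 1 -> phi i0 y <= G x.

Let phi_ge0 i x : 0 <= phi i x. Proof. exact: ltW. Qed.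

Let pow2_gt0 j : 0 < 2 ^+ j :> R. Proof. exact: exprn_gt0. Qed.

(** The normalizing factor turning products of masses of dyadic cells into
    Riemann sums. *)
Let scale j : R := (2 ^+ j) ^+ n / 2 ^+ j.

Let scale_gt0 j : 0 < scale j.
Proof. by rewrite divr_gt0// exprn_gt0. Qed.

(** The approximation of [x |-> \prod_(i < n) phi i x * f x] which is constant
    on the dyadic cells of order [j]. *)
Let step (f : R -> R) j (x : R) : R :=
  (\prod_(i < n) cell_average (P i) j x) * f (dyadic j (dyadic_index j x)).

Let integral_step (f : R -> R) j :
  (forall x, 0 <= f x) -> measurable_fun [set: R] f ->
  (\int[lebesgue_measure]_x (step f j x)%:E =
   (scale j)%:E * \int[dyadic_conflation P j]_x (f x)%:E)%E.
Proof.
move=> f0 mf; rewrite ge0_integral_dyadic_conflation//.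
pose h k := ((2 ^+ j) ^+ n * dyadic_weight P j k) * f (dyadic j k).
have h0 k : 0 <= h k.
  by rewrite mulr_ge0 ?mulr_ge0 ?dyadic_weight_ge0// exprn_ge0// ltW.
transitivity (\int[lebesgue_measure]_x (h (dyadic_index j x))%:E)%E.
  apply: eq_integral => x _; rewrite /step /h /dyadic_weight; congr (_ * _)%:E.
  by rewrite big_split/= prodr_const card_ord.
rewrite integral_dyadic_step// -nneseriesZl; last first.
  move=> m _; rewrite lee_fin mulr_ge0// dyadic_weight_ge0//.
apply: eq_eseriesr => m _; rewrite -EFinM; congr EFin.
by rewrite /h /scale; ring.
Qed.

Let prodphi x := \prod_(i < n) phi i x.

Let prodphi_gt0 x : 0 < prodphi x.
Proof. exact: prodr_gt0. Qed.

Let cprodphi : continuous prodphi.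
Proof.
by apply: continuous_big => [|i _]; [exact: mul_continuous|exact: cphi].
Qed.

Let dominating C x := C * ((\prod_(i < n | i != i0) M i) * G x).

Let integrable_dominating C :
  lebesgue_measure.-integrable [set: R] (EFin \o dominating C).
Proof.
have -> : EFin \o dominating C =
    (fun x => (C * \prod_(i < n | i != i0) M i)%:E * (G x)%:E)%E.
  by apply/funext => x; rewrite /= /dominating -EFinM mulrA.
exact: integrableZl.
Qed.

Let step_dominated (f : R -> R) C j x : (forall y, 0 <= f y <= C) ->
  `|step f j x| <= dominating C x.
Proof.
move=> fC; have f0 y : 0 <= f y by case/andP: (fC y).
rewrite ger0_norm; last first.
  by rewrite mulr_ge0// prodr_ge0// => i _; exact: cell_average_ge0.
rewrite /step /dominating mulrC; apply: ler_pM => //.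
- by apply: prodr_ge0 => i _; exact: cell_average_ge0.
- by case/andP: (fC (dyadic j (dyadic_index j x))).
rewrite (bigD1 i0)//= mulrC; apply: ler_pM.
- by apply: prodr_ge0 => i _; exact: cell_average_ge0.
- exact: cell_average_ge0.
- apply: ler_prod => i _; rewrite cell_average_ge0/=.
  apply: (cell_average_le _ (phi i)) => //; exact: Pphi.
- apply: (cell_average_le _ (phi i0)) => //; first exact: Pphi.
  by move=> y xy; apply: phi_leG; rewrite (le_trans xy)// exp2N_le1.
Qed.

Let measurable_step (f : R -> R) j : measurable_fun [set: R] (step f j).
Proof.
exact: (measurable_fun_dyadic_index j (fun k =>
  (\prod_(i < n) (2 ^+ j * fine (P i (dyadic_cell j k)))) * f (dyadic j k))).
Qed.

Let step_cvg (f : R -> R) x : continuous f ->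
  step f j x @[j --> \oo] --> prodphi x * f x.
Proof.
move=> cf; apply: cvgM; last first.
  exact: (continuous_cvg _ (cf x) (dyadic_index_cvg x)).
apply: cvg_big => [|i _]; first exact: mul_continuous.
by apply: cell_average_cvg => //; exact: Pphi.
Qed.

Let integral_step_cvg (f : R -> R) C : continuous f ->
  (forall y, 0 <= f y <= C) ->
  ((\int[lebesgue_measure]_x (step f j x)%:E)%E @[j --> \oo] -->
   (\int[lebesgue_measure]_x (prodphi x * f x)%:E)%E) /\
  lebesgue_measure.-integrable [set: R] (fun x => (prodphi x * f x)%:E).
Proof.
move=> cf fC.
have [] := @dominated_convergence _ (measurableTypeR R) R lebesgue_measure
  setT measurableT (fun j x => (step f j x)%:E)
  (fun x => (prodphi x * f x)%:E) (EFin \o dominating C).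
- by move=> j; apply/measurable_EFinP; exact (measurable_step f j).
- apply/measurable_EFinP; apply: measurable_funM.
    exact (continuous_measurable_fun cprodphi).
  exact (continuous_measurable_fun cf).
- apply: aeW => x _; apply: cvg_EFin; first by near=> j.
  exact: step_cvg.
- exact: integrable_dominating.
- by apply: aeW => x j _; rewrite lee_fin; exact: step_dominated.
by [].
Unshelve. all: by end_near. Qed.

Let total_step j :
  (\int[lebesgue_measure]_x (step (cst 1) j x)%:E =
   (scale j)%:E * dyadic_conflation P j setT)%E.
Proof.
rewrite integral_step//; congr (_ * _)%E.
transitivity (\int[dyadic_conflation P j]_x (cst 1%E x))%E => //.
by rewrite integral_cst// mul1e.
Qed.

Let total_lty j : (dyadic_conflation P j setT < +oo)%E.
Proof.
have : (\int[lebesgue_measure]_x (step (cst 1) j x)%:E < +oo)%E.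
  apply: le_lt_trans (integrableP _ _ _ (integrable_dominating 1)).2.
  apply: ge0_le_integral => //.
  - move=> x _; rewrite lee_fin mulr_ge0// prodr_ge0// => i _.
    exact: cell_average_ge0.
  - by apply/measurable_EFinP; exact (measurable_step (cst 1) j).
  - apply: measurableT_comp => //.
    exact: measurable_int (integrable_dominating 1).
  - move=> x _; rewrite (le_trans _ (lee_abs _))// lee_fin.
    rewrite (le_trans (ler_norm _))// step_dominated// => y.
    by rewrite ler01 lexx.
rewrite total_step; case: (dyadic_conflation P j setT) => [r| |]//.
- by move=> _; exact: ltry.
- by rewrite gt0_muley ?lte_fin// ltxx.
Qed.

Let total_gt0 j : (0 < dyadic_conflation P j setT)%E.
Proof.
have w_gt0 k : 0 < dyadic_weight P j k.
  apply: prodr_gt0 => i _.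
  have := @cell_average_gt0 _ (P i) (phi i) (cphi i) (Pphi i) j
    (dyadic j k) (phi_gt0 i).
  rewrite /cell_average pmulr_rgt0//.
  rewrite (_ : dyadic_index j (dyadic j k : R) = k)//.
  exact/dyadic_cellE/mem_dyadic_cell_dyadic.
rewrite dyadic_conflationE.
have h0 m : (0 <= (dyadic_weight P j (int_enum m))%:E *
    \d_(dyadic j (int_enum m) : measurableTypeR R) setT)%E.
  by rewrite mule_ge0// lee_fin ltW.
apply: lt_le_trans (nneseries_lim_ge 1 _) => //.
by rewrite big_nat1 diracT mule1 lte_fin.
Qed.

Let ge0_integral_mnormalize_dyadic j (f : R -> R) :
  (forall x, 0 <= f x) -> measurable_fun [set: R] f ->
  (\int[mnormalize (dyadic_conflation P j) point]_x (f x)%:E =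
   ((fine (\int[lebesgue_measure]_x (step (cst 1) j x)%:E))^-1)%:E *
   \int[lebesgue_measure]_x (step f j x)%:E)%E.
Proof.
move=> f0 mf; have t0 := total_gt0 j; have ty := total_lty j.
have tf : dyadic_conflation P j setT \is a fin_num.
  by rewrite ge0_fin_numE// ltW.
have ft0 : 0 < fine (dyadic_conflation P j setT).
  by rewrite fine_gt0// t0.
have fV0 : 0 <= (fine (dyadic_conflation P j setT))^-1 by rewrite invr_ge0 ltW.
rewrite (eq_measure_integral (mscale (NngNum fV0) (dyadic_conflation P j))) =>
    [|A mA _]; last first.
  rewrite -[LHS]/(mnormalize (dyadic_conflation P j) point A) /mnormalize.
  by rewrite gt_eqF//= lt_eqF// muleC.
rewrite ge0_integral_mscale//; last 2 first.
- by apply/measurable_EFinP; exact mf.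
- by move=> x _; rewrite lee_fin.
rewrite total_step integral_step// fineM//= muleA -EFinM.
by congr (_%:E * _)%E; field; rewrite !gt_eqF.
Qed.

(** A distribution whose density is the normalized product of the densities
    [phi i] is a conflation of the [P i]; the normalizing constant [B] is the
    integral of the product. *)
Lemma is_conflation_density (Q : probability (measurableTypeR R) R)
    (g : R -> R) (B : R) :
  0 < B -> (forall x, \prod_(i < n) phi i x = B * g x) ->
  (forall A, measurable A ->
    Q A = (\int[lebesgue_measure]_(x in A) (g x)%:E)%E) ->
  is_conflation P Q.
Proof.
move=> B_gt0 phiB Qg; split=> [j|f cf f0]; first by rewrite total_gt0 total_lty.
have gE : g = fun x => B^-1 * prodphi x.
  by apply/funext => x; rewrite /prodphi phiB mulKf// gt_eqF.
have g_ge0 x : 0 <= g x by rewrite gE mulr_ge0 ?invr_ge0// ltW.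
have mg : measurable_fun [set: R] g.
  rewrite gE; apply: measurable_funM => //.
  exact (continuous_measurable_fun cprodphi).
have [C fC] := continuous_vanishing_bounded f cf f0.
have total1 : (\int[lebesgue_measure]_x (prodphi x * cst 1 x)%:E)%E = B%:E.
  transitivity (\int[lebesgue_measure]_x (B%:E * (g x)%:E))%E.
    by apply: eq_integral => x _; rewrite mulr1 -EFinM /prodphi phiB.
  rewrite ge0_integralZl//; last 3 first.
  - by apply/measurable_EFinP; exact mg.
  - by move=> x _; rewrite lee_fin.
  - by rewrite lee_fin ltW.
  by rewrite -Qg// probability_setT mule1.
(* the case [f = 1], which gives the limit of the rescaled total masses *)
have cvg1 : ((fine (\int[lebesgue_measure]_x (step (cst 1) j x)%:E))^-1)%:E%E
    @[j --> \oo] --> (B^-1)%:E%E.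
  apply: cvg_EFin; first by near=> j.
  apply: cvgV; first by rewrite gt_eqF.
  have [+ _] := integral_step_cvg (cst 1) 1 (fun=> @cvg_cst _ _ _ _ _)
    (fun=> introT andP (conj ler01 (lexx 1))).
  by rewrite total1 => /fine_cvg.
have cvg_ge0 (h : R -> R) D : continuous h -> (forall x, 0 <= h x <= D) ->
    (\int[mnormalize (dyadic_conflation P j) point]_x (h x)%:E)%E
      @[j --> \oo] --> (\int[Q]_x (h x)%:E)%E /\
    (\int[Q]_x (h x)%:E)%E \is a fin_num.
  move=> ch hD; have h0 x : 0 <= h x by case/andP: (hD x).
  have mh : measurable_fun [set: R] h by exact: continuous_measurable_fun.
  have [hcvg hint] := integral_step_cvg h D ch hD.
  have hfin := integrable_fin_num measurableT hint.
  have -> : (\int[Q]_x (h x)%:E =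
      (B^-1)%:E * \int[lebesgue_measure]_x (prodphi x * h x)%:E)%E.
    rewrite (ge0_integral_density Q g (EFin \o h) g_ge0 mg Qg); last 2 first.
    - by move=> x; rewrite lee_fin.
    - by apply/measurable_EFinP; exact mh.
    rewrite -integralZl//; apply: eq_integral => x _.
    by rewrite -!EFinM gE; congr EFin; ring.
  split; last by rewrite fin_numM.
  under eq_fun do rewrite ge0_integral_mnormalize_dyadic//.
  by apply: cvgeM => //; rewrite mule_def_fin.
pose fp x := Num.max (f x) 0; pose fn x := Num.max (- f x) 0.
have cfp : continuous fp.
  by move=> x; apply: continuous_max; [exact: cf|exact: cvg_cst].
have cfn : continuous fn.
  move=> x; apply: (@continuous_max _ _ (fun x => - f x) (cst 0)).
    exact: continuousN (cf x).
  exact: cvg_cst.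
have fpC x : 0 <= fp x <= C.
  rewrite /fp le_max lexx orbT/= ge_max (le_trans (ler_norm _) (fC x))/=.
  exact: le_trans (normr_ge0 _) (fC x).
have fnC x : 0 <= fn x <= C.
  rewrite /fn le_max lexx orbT/= ge_max (le_trans (ler_norm _))/= ?normrN//.
  exact: le_trans (normr_ge0 _) (fC x).
have posE : (fun x : measurableTypeR R => (f x)%:E)^\+%E = (fun x => (fp x)%:E).
  by apply/funext => x; rewrite funeposE EFin_max.
have negE : (fun x : measurableTypeR R => (f x)%:E)^\-%E = (fun x => (fn x)%:E).
  by apply/funext => x; rewrite funenegE EFin_max.
rewrite [X in _ --> X]integralE posE negE.
under eq_fun do rewrite integralE posE negE.
have [pcvg pfin] := cvg_ge0 _ _ cfp fpC.
have [ncvg nfin] := cvg_ge0 _ _ cfn fnC.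
by apply: cvgeB => //; exact: fin_num_adde_defr.
Unshelve. all: by end_near. Qed.

End conflation_density.

(** * Normal distributions *)

(** The reflection of the real line about [m]. *)
Definition reflection {R : realType} (m : R) (x : measurableTypeR R) :
  measurableTypeR R := 2 * m - x.

Section reflection.
Context {R : realType}.
Variable m : R.

Let measurable_reflection :
  measurable_fun [set: measurableTypeR R] (reflection m).
Proof.
have : measurable_fun [set: R] (fun x : R => 2 * m - x).
  exact: measurable_funB.
exact.
Qed.

HB.instance Definition _ :=
  isMeasurableFun.Build _ _ _ _ (reflection m) measurable_reflection.

Let reflection_itv a b :
  reflection m @^-1` `]a, b] = `[2 * m - b, 2 * m - a[%classic.
Proof.
apply/seteqP; split => x; rewrite /= !in_itv/= /reflection => /andP[] h1 h2.
  by apply/andP; split; lra.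
by apply/andP; split; lra.
Qed.

Lemma lebesgue_measure_reflection (A : set R) : measurable A ->
  pushforward lebesgue_measure (reflection m) A = lebesgue_measure A.
Proof.
move=> mA; apply/esym/lebesgue_measure_unique => //= _ [[a b]] _ <-.
rewrite /pushforward reflection_itv !lebesgue_measure_itv/= !lte_fin.
by rewrite ltrD2l ltrN2 -!EFinB; case: ifP => // _; congr EFin; lra.
Qed.

Lemma normal_fun_reflection s (x : R) :
  normal_fun m s (2 * m - x) = normal_fun m s x.
Proof.
rewrite /normal_fun; have -> : (2 * m - x - m) ^+ 2 = (x - m) ^+ 2 by ring.
by [].
Qed.

Lemma normal_prob_reflection s (A : set R) : s != 0 -> measurable A ->
  pushforward (normal_prob m s) (reflection m) A = normal_prob m s A.
Proof.
move=> s0 mA; rewrite /pushforward /normal_prob.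
transitivity (\int[pushforward lebesgue_measure (reflection m)]_(x in A)
    (normal_pdf m s x)%:E)%E.
  rewrite ge0_integral_pushforward; last 4 first.
  - exact: measurable_reflection.
  - exact: mA.
  - apply/measurable_EFinP/measurable_funTS.
    exact (measurable_normal_pdf m s).
  - by move=> y _; rewrite lee_fin normal_pdf_ge0.
  apply: eq_integral => x _ /=.
  by rewrite normal_pdfE// [X in _ = (_ * X)%:E]normal_fun_reflection.
by apply: eq_measure_integral => B mB _; exact: lebesgue_measure_reflection.
Qed.

End reflection.

Section normal_tails.
Context {R : realType}.
Implicit Types m s x y : R.

Lemma normal_fun_sqrt2E m s x :
  normal_fun m (Num.sqrt 2 * s) x = expR (- (x - m) ^+ 2 / (4 * s ^+ 2)).
Proof.
rewrite /normal_fun exprMn sqr_sqrtr//; congr (expR (- _ / _)).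
by rewrite -mulr_natr; ring.
Qed.

(** A Gaussian shifted by at most [1] stays below a multiple of the wider
    Gaussian. *)
Lemma normal_fun_shift_le m s x y : s != 0 -> `|x - y| <= 1 ->
  normal_fun m s y <= expR (2 * s ^+ 2)^-1 * normal_fun m (Num.sqrt 2 * s) x.
Proof.
move=> s0 xy; rewrite normal_fun_sqrt2E /normal_fun -expRD ler_expR.
have s2 : 0 < s ^+ 2 by rewrite exprn_even_gt0.
rewrite -mulr_natr -subr_ge0.
have -> : (2 * s ^+ 2)^-1 + - (x - m) ^+ 2 / (4 * s ^+ 2) -
    - (y - m) ^+ 2 / (s ^+ 2 * 2) =
    (2 - (x - m) ^+ 2 + 2 * (y - m) ^+ 2) / (4 * s ^+ 2).
  by field.
apply: divr_ge0; last by rewrite mulr_ge0// ltW.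
have : (x - y) ^+ 2 <= 1 by rewrite -real_normK ?num_real// expr_le1.
by have := sqr_ge0 (2 * y - m - x); nra.
Qed.

(** The integrand of the first absolute moment of a Gaussian is dominated by a
    wider Gaussian. *)
Lemma normr_normal_fun_le m s x : s != 0 ->
  `|x| * normal_fun m s x <=
  (`|m| + 1 + 4 * s ^+ 2) * normal_fun m (Num.sqrt 2 * s) x.
Proof.
move=> s0; rewrite normal_fun_sqrt2E /normal_fun.
have s2 : 0 < s ^+ 2 by rewrite exprn_even_gt0.
set u := (x - m) ^+ 2 / (4 * s ^+ 2).
have u0 : 0 <= u by rewrite divr_ge0 ?sqr_ge0// mulr_ge0// ltW.
have -> : - (x - m) ^+ 2 / (s ^+ 2 *+ 2) = - u + - u.
  by rewrite /u -mulr_natr; field.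
have -> : - (x - m) ^+ 2 / (4 * s ^+ 2) = - u by rewrite mulNr.
rewrite expRD mulrA ler_pM2r ?expR_gt0// expRN ler_pdivrMr ?expR_gt0//.
have uE : (x - m) ^+ 2 = 4 * s ^+ 2 * u.
  by rewrite /u mulrC divfK// gt_eqF// mulr_gt0.
have xm : `|x| <= `|m| + 1 + 4 * s ^+ 2 * u.
  rewrite -uE -[x in leLHS](subrK m) (le_trans (ler_normD _ _))//.
  rewrite addrC -addrA lerD2l -real_normK ?num_real//.
  by have := sqr_ge0 (`|x - m| - 1); have := normr_ge0 (x - m); nra.
have e1 := expR_ge1Dx u.
have m0 := normr_ge0 m.
apply: (le_trans xm).
apply: (@le_trans _ _ ((`|m| + 1 + 4 * s ^+ 2) * (1 + u))).
  by nra.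
by rewrite ler_wpM2l//; nra.
Qed.

Lemma integrable_normal_fun m s : s != 0 ->
  lebesgue_measure.-integrable [set: R] (EFin \o normal_fun m s).
Proof.
move=> s0.
have -> : EFin \o normal_fun m s =
    (fun x => (normal_peak s)^-1%:E * (normal_pdf m s x)%:E)%E.
  apply/funext => x; rewrite /= normal_pdfE// -EFinM mulKf//.
  by rewrite gt_eqF// normal_peak_gt0.
by apply: integrableZl => //; exact: integrable_normal_pdf.
Qed.

End normal_tails.

Section normal_mean.
Context {R : realType}.
Variables (m s : R).
Hypothesis s0 : s != 0.

Lemma ge0_integral_normal_prob (f : R -> \bar R) :
  (forall x, (0 <= f x)%E) -> measurable_fun [set: R] f ->
  (\int[normal_prob m s]_x f x =
   \int[lebesgue_measure]_x (f x * (normal_pdf m s x)%:E))%E.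
Proof.
apply: ge0_integral_density => //; first by move=> x; exact: normal_pdf_ge0.
exact: measurable_normal_pdf.
Qed.

Lemma has_mean_normal_prob : has_mean (normal_prob m s).
Proof.
have mid : measurable_fun [set: R] (fun x : R => (`|x|)%:E).
  by apply/measurable_EFinP; exact: normr_measurable.
apply/integrableP; split; first by apply/measurable_EFinP; exact: measurable_id.
rewrite (ge0_integral_normal_prob (fun x => `|x%:E|%E))//=.
pose K := (`|m| + 1 + 4 * s ^+ 2) * normal_peak s.
have K0 : 0 <= K.
  by rewrite mulr_ge0 ?normal_peak_ge0// !addr_ge0// mulr_ge0// sqr_ge0.
have r20 : Num.sqrt 2 * s != 0 by rewrite mulf_neq0// gt_eqF// sqrtr_gt0.
apply: (@le_lt_trans _ _ (\int[lebesgue_measure]_x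
    (K%:E * (normal_fun m (Num.sqrt 2 * s) x)%:E))%E).
  apply: ge0_le_integral => //.
  - by move=> x _; rewrite mule_ge0// lee_fin normal_pdf_ge0.
  - apply: emeasurable_funM; first exact mid.
    by apply/measurable_EFinP; exact (measurable_normal_pdf m s).
  - apply/measurable_EFinP; apply: measurable_funM => //.
    exact (measurable_normal_fun m _).
  - move=> x _; rewrite -!EFinM lee_fin normal_pdfE// /K.
    have le := ler_wpM2l (normal_peak_ge0 s) (normr_normal_fun_le m s x s0).
    apply: le_trans (le_trans le _); rewrite le_eqVlt; apply/orP; left.
      by apply/eqP; ring.
    by apply/eqP; ring.
rewrite integralZl//; last exact: integrable_normal_fun.
have fin := integrable_fin_num measurableT (integrable_normal_fun m _ r20).
rewrite lte_mul_pinfty//.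
by move: fin; rewrite fin_numE => /andP[_]; rewrite ltey.
Qed.

(** The law being invariant under [reflection m], its mean [M] satisfies
    [M = 2 * m - M]. *)
Lemma mean_normal_prob : mean (normal_prob m s) = m.
Proof.
have ix := has_mean_normal_prob.
pose Q : probability (measurableTypeR R) R := normal_prob m s.
have mE : measurable_fun [set: measurableTypeR R] (EFin : R -> \bar R).
  exact: measurable_int ix.
have ic c : Q.-integrable [set: R] (fun _ => c%:E).
  exact: finite_measure_integrable_cst.
have ixm : Q.-integrable [set: R] (fun x : R => (2 * m)%:E - x%:E)%E.
  exact: integrableB.
have fin : (\int[Q]_x x%:E)%E \is a fin_num by exact: (integrable_fin_num _ ix).
have : (\int[Q]_x x%:E = (2 * m)%:E - \int[Q]_x x%:E)%E.
  transitivity (\int[pushforward Q (reflection m)]_x x%:E)%E.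
    apply: eq_measure_integral => A mA _.
    exact/esym/(normal_prob_reflection m s A s0 mA).
  rewrite integral_pushforward//=.
  transitivity (\int[Q]_x ((2 * m)%:E - x%:E))%E.
    by apply: eq_integral => x _; rewrite /reflection EFinB.
  by rewrite integralB// integral_cst//= probability_setT mule1.
rewrite /mean /Rintegral -/Q -(fineK fin) -EFinB => -[eqm].
by lra.
Qed.

End normal_mean.

(** The product of Gaussian densities is, up to a constant, the Gaussian
    density whose mean is the precision-weighted mean and whose precision is
    the sum of the precisions: complete the square. *)
Lemma prod_normal_pdf {R : realType} {n} (x s : 'I_n -> R) :
  (0 < n)%N -> (forall i, 0 < s i) ->
  exists2 B, 0 < B & forall y,
    \prod_(i < n) normal_pdf (x i) (s i) y =
    B * normal_pdf (\sum_(i < n) precision_weight s i * x i)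
          (Num.sqrt (precision s))^-1 y.
Proof.
move=> n_gt0 s_gt0; have tau0 := precision_gt0 s n_gt0 s_gt0.
set m := \sum_(i < n) _; set sd := (Num.sqrt _)^-1.
have sd0 : sd != 0 by rewrite invr_eq0 gt_eqF// sqrtr_gt0.
have sd2 : sd ^+ 2 = (precision s)^-1 by rewrite exprVn sqr_sqrtr// ltW.
have s0 i : s i != 0 by rewrite gt_eqF.
pose c := \sum_(i < n) - (x i - m) ^+ 2 / (s i ^+ 2 *+ 2).
exists ((\prod_(i < n) normal_peak (s i)) / normal_peak sd * expR c).
  rewrite mulr_gt0 ?expR_gt0// divr_gt0 ?normal_peak_gt0//.
  by apply: prodr_gt0 => i _; exact: normal_peak_gt0.
move=> y; rewrite normal_pdfE//.
under eq_bigr do rewrite normal_pdfE//.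
rewrite big_split/= -expR_sum mulrAC -!mulrA; congr (_ * _).
rewrite mulKf; last by rewrite gt_eqF// normal_peak_gt0.
rewrite /normal_fun -expRD; congr expR.
rewrite sd2.
(* the linear term vanishes, as [m] is the weighted mean *)
have cross : \sum_(i < n) (x i - m) / s i ^+ 2 * (y - m) = 0.
  rewrite -mulr_suml; apply/eqP; rewrite mulf_eq0; apply/orP; left; apply/eqP.
  under eq_bigr do rewrite mulrBl.
  rewrite sumrB -mulr_sumr -/(precision s) /m mulr_suml; apply/eqP.
  rewrite subr_eq0; apply/eqP/eq_bigr => i _; rewrite /precision_weight.
  by field; rewrite s0 gt_eqF.
have -> : - (y - m) ^+ 2 / ((precision s)^-1 *+ 2) =
    \sum_(i < n) - (y - m) ^+ 2 / 2 * (s i ^+ 2)^-1.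
  rewrite -mulr_sumr -/(precision s) -[_ *+ 2]mulr_natr; field.
  by rewrite gt_eqF.
rewrite -[RHS]addr0 -[X in _ = _ + X]cross /c -!big_split/=.
apply: eq_bigr => i _; rewrite -[_ *+ 2]mulr_natr; field.
exact: s0.
Qed.

(** * Conflation of normal distributions *)

Section normal_conflation.
Context {R : realType} {n : nat}.
Variables (x s : 'I_n -> R).
Hypothesis n_gt0 : (0 < n)%N.
Hypothesis s_gt0 : forall i, 0 < s i.

Let s0 i : s i != 0. Proof. by rewrite gt_eqF. Qed.

Let N i : probability (measurableTypeR R) R := normal_prob (x i) (s i).

Let m : R := \sum_(i < n) precision_weight s i * x i.

Let sd : R := (Num.sqrt (precision s))^-1.

Lemma is_conflation_normal : is_conflation N (normal_prob m sd).
Proof.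
have [B B_gt0 prodE] := prod_normal_pdf x s n_gt0 s_gt0.
pose i0 := Ordinal n_gt0.
pose G y := normal_peak (s i0) *
  (expR (2 * s i0 ^+ 2)^-1 * normal_fun (x i0) (Num.sqrt 2 * s i0) y).
have iG : lebesgue_measure.-integrable [set: R] (EFin \o G).
  have -> : EFin \o G = (fun y =>
      (normal_peak (s i0) * expR (2 * s i0 ^+ 2)^-1)%:E *
      (normal_fun (x i0) (Num.sqrt 2 * s i0) y)%:E)%E.
    by apply/funext => y; rewrite /G/= -EFinM mulrA.
  apply: integrableZl => //; apply: integrable_normal_fun.
  by rewrite mulf_neq0// gt_eqF// sqrtr_gt0.
apply: (@is_conflation_density _ _ N (fun i => normal_pdf (x i) (s i)) _ _ _
  (fun i => normal_peak (s i)) i0 G _ iG _ _ _ _ B_gt0 prodE).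
- by move=> i y; rewrite normal_pdfE// mulr_gt0 ?normal_peak_gt0 ?expR_gt0.
- by move=> i; exact: continuous_normal_pdf.
- by [].
- by move=> i y; exact: normal_pdf_ub.
- move=> y z yz; rewrite normal_pdfE// /G ler_wpM2l ?normal_peak_ge0//.
  exact: normal_fun_shift_le.
- by [].
Qed.

(** Any two conflations agree on measurable sets, whichever one [get]
    selects. *)
Lemma conflation_normalE A : measurable A ->
  conflation N A = normal_prob m sd A.
Proof.
have [_ vN] := is_conflation_normal.
have [_ vQ] : is_conflation N (conflation N).
  by apply: getPex; eexists; exact: is_conflation_normal.
exact: vague_limit_unique vQ vN A.
Qed.

Let sd0 : sd != 0.
Proof. by rewrite invr_eq0 gt_eqF// sqrtr_gt0; exact: precision_gt0. Qed.

Lemma has_mean_conflation_normal : has_mean (conflation N).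
Proof.
have /integrableP[mid ifin] := has_mean_normal_prob m sd sd0.
apply/integrableP; split => //.
by rewrite (eq_measure_integral (normal_prob m sd)) => // A mA _;
  exact: conflation_normalE.
Qed.

Lemma mean_conflation_normal : mean (conflation N) = m.
Proof.
rewrite -(mean_normal_prob m sd sd0) /mean /Rintegral; congr fine.
by apply: eq_measure_integral => A mA _; exact: conflation_normalE.
Qed.

End normal_conflation.

Theorem theorem6p4 (R : realType) (d : measure_display) (T : measurableType d)
    (n : nat) (n_gt0 : (0 < n)%N) (Par : set R) (P : R -> probability T R)
    (X : 'I_n -> {mfun T >-> R}) (sigma : 'I_n -> R) :
  (exists2 theta, Par theta & theta != 0) ->
  (forall theta, Par theta -> mutually_independent (P theta) X) ->
  (forall i, unbiased Par P (X i)) ->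
  (forall i, 0 < sigma i) ->
  (forall theta, Par theta ->
    forall i, ('V_(P theta)[X i] = (sigma i ^+ 2)%:E)%E) ->
  let N := fun (w : T) (i : 'I_n) =>
    (normal_prob (X i w) (sigma i) : probability (measurableTypeR R) R) in
  let Theta := fun w : T => mean (conflation (N w)) in
  [/\ forall w, is_conflation (N w) (conflation (N w)),
      forall w, has_mean (conflation (N w)),
      is_BLUE Par P X Theta &
      forall Z : T -> R, is_BLUE Par P X Z -> Z = Theta].
Proof.
move=> Par_neq0 indX unbX sigma_gt0 varX N Theta.
have ThetaE : Theta = precision_mean X sigma.
  by apply/funext => w; exact: mean_conflation_normal.
split=> [w|w||Z].
- by apply: getPex; eexists; exact: is_conflation_normal.
- exact: has_mean_conflation_normal.
- by rewrite ThetaE; exact: precision_mean_BLUE.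
- by rewrite ThetaE; exact: BLUE_unique.
Qed.
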